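(* Let $Q$ be a finite quiver and $\mathbf d$ a dimension vector. Then the map $$\mathfrak{gl}_{\mathbf d}(\mathbb K)\to\mathcal D_\hbar(\mathrm{Rep}^Q_{\mathbf d}),\qquad v\mapsto\mathrm{tr}([\widehat{\mathbf w}]v)$$ is a quantum moment map for $\mathrm{Rep}^{\overline Q}_{\mathbf d}$. Furthermore, for an arbitrary $\mathbf r=\sum_{i\in Q_0}r_ie_i\in R$, the map $$\mathfrak{gl}_{\mathbf d}(\mathbb K)\to\mathcal D_\hbar(\mathrm{Rep}^Q_{\mathbf d}),\qquad v\mapsto\mathrm{tr}\Big(\big([\widehat{\mathbf w}]+\hbar\sum_{i\in Q_0}r_iI_i\big)v\Big)$$ is also a quantum moment map, where $I_i$ is the identity matrix at the $i$-th component and zero elsewhere.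
   Context: $\mathbb K$ is an algebraically closed field of characteristic zero. $Q$ has vertex set $Q_0$; the set of arrows is also written $Q$; $s(a),t(a)$ are source and target. $\overline Q$ is the double of $Q$, obtained by adding a reverse arrow $a^*$ for each $a\in Q$. $R=\bigoplus_{i\in Q_0}\mathbb Ke_i$. For $\mathbf d=(d_i)$, $\mathrm{Rep}^Q_{\mathbf d}$ is the space of representations of $Q$ on $\mathbb K^{\mathbf d}=\bigoplus_i\mathbb K^{d_i}$, with coordinates $(a)_{p,q}$, $a\in Q$, $1\le p\le d_{t(a)}$, $1\le q\le d_{s(a)}$; $\mathrm{Rep}^{\overline Q}_{\mathbf d}=T^*\mathrm{Rep}^Q_{\mathbf d}$. $\mathfrak{gl}_{\mathbf d}(\mathbb K)=\bigoplus_{i\in Q_0}\mathfrak{gl}_{d_i}(\mathbb K)$, with elementary matrices $e^i_{p,q}$, is the Lie algebra of $\mathrm{GL}_{\mathbf d}(\mathbb K)=\prod_i\mathrm{GL}_{d_i}(\mathbb K)$, acting by conjugation. **Differential operators.** $\mathcal D_\hbar(\mathrm{Rep}^Q_{\mathbf d})$ is the Rees algebra of the algebra of differential operators filtered by order: graded, functions in degree $0$, $\hbar$ and derivations $\frac{\partial}{\partial(a)_{q,p}}$ in degree $1$, with $\big[\frac{\partial}{\partial(a)_{p,q}},(b)_{k,l}\big]=\hbar\,\delta_{a,b}\delta_{p,k}\delta_{q,l}$. For $a\in Q$, $[a]$ is the matrix with entries $[a]_{p,q}=(a)_{p,q}$ and $[a^*]$ is the $d_{s(a)}\times d_{t(a)}$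 matrix with entries $[a^*]_{p,q}=\frac{\partial}{\partial(a)_{q,p}}$. **$\mathfrak{gl}_{\mathbf d}$-action.** $v.D=\frac1\hbar[\tau(v),D]$, where $$\tau(e^i_{p,q})=\sum_{a\in Q,\,s(a)=i}\sum_{j=1}^{d_{t(a)}}[a]_{j,p}\frac{\partial}{\partial(a)_{j,q}}-\sum_{a\in Q,\,t(a)=i}\sum_{j=1}^{d_{s(a)}}[a]_{q,j}\frac{\partial}{\partial(a)_{p,j}}.$$ **Noncommutative quantum moment map.** $\widehat{\mathbf w}=\sum_{a\in Q}\big((a,1)(a^*,2)-(a^*,1)(a,2)\big)$ is the lifting of $\mathbf w=\sum_{a\in Q}(aa^*-a^*a)$ to the quantum path algebra (the integers record the order of multiplication). The associated block-diagonal matrix $[\widehat{\mathbf w}]$ with entries in $\mathcal D_\hbar(\mathrm{Rep}^Q_{\mathbf d})$ is $[\widehat{\mathbf w}]=\sum_{a\in Q}([a][a^*]-[a^*][a])$; its $i$-th block is $\sum_{t(a)=i}[a][a^*]-\sum_{s(a)=i}[a^*][a]$, products of entries being taken in $\mathcal D_\hbar$ in the written order. **Quantum moment map.** Let $A_\hbar$ be a flat graded $\mathbb K[\hbar]$-algebra with an action of a Lie algebra $\mathfrak g$ of an algebraic group. A map $\mu_\hbar:\mathcal U_\hbar\mathfrak g\to A_\hbar$ (a $\mathbb K[\hbar]$-algebra homomorphism, identified with its restriction to $\mathfrak g$) is a quantum moment map if $\mu_\hbar(\mathfrak g)\subset(A_\hbar)_1$ and for every $v\in\mathfrak g$ the map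 $x\mapsto\frac{-1}{\hbar}[\mu_\hbar(v),x]$ is the action of $v$ on $A_\hbar$. Here $\mathcal U_\hbar\mathfrak g$ is the homogenized enveloping algebra, generated over $\mathbb K[\hbar]$ by $\mathfrak g$ in degree $1$ with relations $xy-yx=-\hbar[x,y]$. *)

(* Defs.v *)
From HB Require Import structures.
From mathcomp Require Import all_boot all_order all_algebra.
From mathcomp Require Import boolp.
From mathcomp Require Import mpoly.

Set Implicit Arguments.
Unset Strict Implicit.
Unset Printing Implicit Defensive.

Import GRing.Theory.
Local Open Scope ring_scope.

(** * Lie algebras *)

Record lieAlgebra (K : fieldType) := LieAlgebra {
  lie_sort :> lmodType K;
  lie_bracket : lie_sort -> lie_sort -> lie_sort;
  lie_linearl : forall y, linear (lie_bracket^~ y);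
  lie_linearr : forall x, linear (lie_bracket x);
  lie_alternating : forall x, lie_bracket x x = 0;
  lie_jacobi : forall x y z,
    lie_bracket x (lie_bracket y z) + lie_bracket y (lie_bracket z x)
      + lie_bracket z (lie_bracket x y) = 0 }.

Definition comm (A : pzRingType) (x y : A) : A := x * y - y * x.

(** * Flat graded K[hbar]-algebras with a Lie algebra action

    K[hbar] is [{poly K}], with hbar = ['X]. *)

(* Equational criterion: every linear relation in M is a consequence of
   relations in R. *)
Definition flat_module (R : comNzRingType) (M : lmodType R) : Prop :=
  forall (n : nat) (r : 'rV[R]_n) (x : 'I_n -> M),
    \sum_i r 0 i *: x i = 0 ->
    exists (m : nat) (A : 'M[R]_(n, m)) (y : 'I_m -> M),
      r *m A = 0 /\ forall i, x i = \sum_j A i j *: y j.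

Section GradedAction.
Variables (K : fieldType) (g : lieAlgebra K) (A : algType {poly K}).

Definition hbar : A := 'X%:A.
Definition cst (c : K) : A := c%:P%:A.

Record grading (deg : nat -> A -> Prop) : Prop := Grading {
  deg_linear : forall n (c : K) x y,
    deg n x -> deg n y -> deg n (c%:P *: x + y);
  deg_one : deg 0%N 1;
  deg_mul : forall m n x y, deg m x -> deg n y -> deg (m + n)%N (x * y);
  deg_hbar : deg 1%N hbar;
  deg_span : forall x, exists (N : nat) (c : nat -> A),
    (forall i, deg i (c i)) /\ x = \sum_(i < N) c i;
  deg_direct : forall (N : nat) (c : nat -> A),
    (forall i, deg i (c i)) -> \sum_(i < N) c i = 0 ->
    forall i, (i < N)%N -> c i = 0 }.

Record lie_action (deg : nat -> A -> Prop) (act : g -> A -> A) : Prop :=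
  LieAction {
  act_linearl : forall (c : K) v w x,
    act (c *: v + w) x = c%:P *: act v x + act w x;
  act_linearr : forall v, linear (act v);
  act_leibniz : forall v x y, act v (x * y) = act v x * y + x * act v y;
  act_bracket : forall v w x,
    act (lie_bracket v w) x = act v (act w x) - act w (act v x);
  act_deg : forall n v x, deg n x -> deg n (act v x) }.

End GradedAction.

Arguments hbar {K A}.
Arguments cst {K A}.

(** * The homogenized enveloping algebra

    The K[hbar]-algebra generated by g with relations x y - y x = - hbar [x, y]:
    formal expressions modulo the congruence generated by the axioms of
    K[hbar]-algebras, the K-linearity of the generators, and those relations. *)

Inductive uexpr (K : fieldType) (g : lieAlgebra K) : Type :=
  | UScalar of {poly K}
  | UGen of g
  | UAdd of uexpr g & uexpr g
  | UMul of uexpr g & uexpr g.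
Arguments UScalar {K g}.

Inductive ucong (K : fieldType) (g : lieAlgebra K) : uexpr g -> uexpr g -> Prop :=
  | ucong_refl x : ucong x x
  | ucong_sym x y : ucong x y -> ucong y x
  | ucong_trans x y z : ucong x y -> ucong y z -> ucong x z
  | ucong_add x x' y y' : ucong x x' -> ucong y y' -> ucong (UAdd x y) (UAdd x' y')
  | ucong_mul x x' y y' : ucong x x' -> ucong y y' -> ucong (UMul x y) (UMul x' y')
  | ucong_addA x y z : ucong (UAdd x (UAdd y z)) (UAdd (UAdd x y) z)
  | ucong_addC x y : ucong (UAdd x y) (UAdd y x)
  | ucong_add0 x : ucong (UAdd (UScalar 0) x) x
  | ucong_mulA x y z : ucong (UMul x (UMul y z)) (UMul (UMul x y) z)
  | ucong_mul1 x : ucong (UMul (UScalar 1) x) x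
  | ucong_mul0 x : ucong (UMul (UScalar 0) x) (UScalar 0)
  | ucong_mulDl x y z : ucong (UMul (UAdd x y) z) (UAdd (UMul x z) (UMul y z))
  | ucong_mulDr x y z : ucong (UMul x (UAdd y z)) (UAdd (UMul x y) (UMul x z))
  | ucong_scalarD p q : ucong (UScalar (p + q)) (UAdd (UScalar p) (UScalar q))
  | ucong_scalarM p q : ucong (UScalar (p * q)) (UMul (UScalar p) (UScalar q))
  | ucong_central p x : ucong (UMul (UScalar p) x) (UMul x (UScalar p))
  | ucong_genD v w : ucong (UGen (v + w)) (UAdd (UGen v) (UGen w))
  | ucong_genZ (c : K) v : ucong (UGen (c *: v)) (UMul (UScalar c%:P) (UGen v))
  | ucong_comm v w :
      ucong (UAdd (UMul (UGen v) (UGen w))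
                  (UMul (UScalar (-1)) (UMul (UGen w) (UGen v))))
            (UMul (UScalar (- 'X)) (UGen (lie_bracket v w))).

HB.instance Definition _ (K : fieldType) (g : lieAlgebra K) :=
  gen_eqMixin (uexpr g).
HB.instance Definition _ (K : fieldType) (g : lieAlgebra K) :=
  gen_choiceMixin (uexpr g).

Section Enveloping.
Variables (K : fieldType) (g : lieAlgebra K).
Local Open Scope quotient_scope.

Definition ucongb : rel (uexpr g) := fun x y => `[< ucong x y >].

Lemma ucongb_refl : reflexive ucongb.
Proof. by move=> x; apply/asboolP; constructor. Qed.
Lemma ucongb_sym : ssrbool.symmetric ucongb.
Proof. by move=> x y; apply/asboolP/asboolP; apply: ucong_sym. Qed.
Lemma ucongb_trans : transitive ucongb.
Proof.
move=> y x z /asboolP xy /asboolP yz.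
by apply/asboolP; apply: ucong_trans xy yz.
Qed.

Canonical ucong_equiv := EquivRel ucongb ucongb_refl ucongb_sym ucongb_trans.

Definition Uh : Type := {eq_quot ucong_equiv}.
HB.instance Definition _ := Choice.on Uh.
HB.instance Definition _ := Quotient.on Uh.

Definition upi (x : uexpr g) : Uh := \pi_Uh x.

Lemma upiP x y : upi x = upi y <-> ucong x y.
Proof.
rewrite /upi; split; first by move/eqquotP => /asboolP.
by move=> h; apply/eqquotP/asboolP.
Qed.

Lemma upi_surj (x : Uh) : exists e, x = upi e.
Proof. by exists (repr x); rewrite /upi reprK. Qed.

Lemma ucong_repr x : ucong (repr (upi x)) x.
Proof. by apply/upiP; rewrite /upi reprK. Qed.

Definition uadd (x y : Uh) : Uh := upi (UAdd (repr x) (repr y)).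
Definition umul (x y : Uh) : Uh := upi (UMul (repr x) (repr y)).
Definition uopp (x : Uh) : Uh := umul (upi (UScalar (-1))) x.
Definition uscale (p : {poly K}) (x : Uh) : Uh := umul (upi (UScalar p)) x.

Lemma uaddE x y : uadd (upi x) (upi y) = upi (UAdd x y).
Proof. by apply/upiP/ucong_add; apply: ucong_repr. Qed.
Lemma umulE x y : umul (upi x) (upi y) = upi (UMul x y).
Proof. by apply/upiP/ucong_mul; apply: ucong_repr. Qed.

Local Ltac upi_intro := repeat (let x := fresh "x" in
  move=> x; try (case: (upi_surj x) => {}x ->)).

Lemma uaddA : associative uadd.
Proof. by upi_intro; rewrite !uaddE; apply/upiP/ucong_addA. Qed.
Lemma uaddC : commutative uadd.
Proof. by upi_intro; rewrite !uaddE; apply/upiP/ucong_addC. Qed.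
Lemma uadd0 : left_id (upi (UScalar 0)) uadd.
Proof. by upi_intro; rewrite !uaddE; apply/upiP/ucong_add0. Qed.
Lemma umulA : associative umul.
Proof. by upi_intro; rewrite !umulE; apply/upiP/ucong_mulA. Qed.
Lemma umul1 : left_id (upi (UScalar 1)) umul.
Proof. by upi_intro; rewrite !umulE; apply/upiP/ucong_mul1. Qed.
Lemma umulC p x : umul (upi (UScalar p)) x = umul x (upi (UScalar p)).
Proof. by case: (upi_surj x) => {}x ->; rewrite !umulE; apply/upiP/ucong_central. Qed.
Lemma umulDl : left_distributive umul uadd.
Proof. by upi_intro; rewrite !(uaddE, umulE); apply/upiP/ucong_mulDl. Qed.
Lemma umulDr : right_distributive umul uadd.
Proof. by upi_intro; rewrite !(uaddE, umulE); apply/upiP/ucong_mulDr. Qed.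
Lemma uscalarD p q :
  upi (UScalar (p + q)) = uadd (upi (UScalar p)) (upi (UScalar q)).
Proof. by rewrite uaddE; apply/upiP/ucong_scalarD. Qed.
Lemma uscalarM p q :
  upi (UScalar (p * q)) = umul (upi (UScalar p)) (upi (UScalar q)).
Proof. by rewrite umulE; apply/upiP/ucong_scalarM. Qed.
Lemma umulr1 : right_id (upi (UScalar 1)) umul.
Proof. by move=> x; rewrite -umulC umul1. Qed.

Lemma umul0 x : umul (upi (UScalar 0)) x = upi (UScalar 0).
Proof. by case: (upi_surj x) => {}x ->; rewrite umulE; apply/upiP/ucong_mul0. Qed.
Lemma uaddN : left_inverse (upi (UScalar 0)) uopp uadd.
Proof. by move=> x; rewrite /uopp -[X in uadd _ X]umul1 -umulDl -uscalarD addNr umul0. Qed.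

(* Evaluation of expressions: a linear map from g to a K[hbar]-algebra
   satisfying the commutation relations factors through the congruence. *)
Fixpoint ueval (A : algType {poly K}) (f : g -> A) (x : uexpr g) : A :=
  match x with
  | UScalar p => p%:A
  | UGen v => f v
  | UAdd y z => ueval f y + ueval f z
  | UMul y z => ueval f y * ueval f z
  end.

Lemma ueval_cong (A : algType {poly K}) (f : g -> A) :
  (forall (c : K) v w, f (c *: v + w) = c%:P *: f v + f w) ->
  (forall v w, comm (f v) (f w) = - (hbar * f (lie_bracket v w))) ->
  forall x y, ucong x y -> ueval f x = ueval f y.
Proof.
move=> flin fcomm x y; elim=> /=; try congruence.
- by move=> *; rewrite addrA.
- by move=> *; rewrite addrC.
- by move=> *; rewrite scale0r add0r.
- by move=> *; rewrite mulrA.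
- by move=> *; rewrite scale1r mul1r.
- by move=> *; rewrite scale0r mul0r.
- by move=> *; rewrite mulrDl.
- by move=> *; rewrite mulrDr.
- by move=> *; rewrite scalerDl.
- by move=> *; rewrite -scalerAl mul1r scalerA.
- by move=> *; rewrite -scalerAl -scalerAr mul1r mulr1.
- by move=> v w; rewrite -[v]scale1r flin !scale1r.
- have f0 : f 0 = 0.
    by have /eqP := flin 1 0 0; rewrite !scale1r addr0 -subr_eq0 opprD addrA addrN
      sub0r oppr_eq0 => /eqP.
  by move=> c v; rewrite -[c *: v]addr0 flin f0 addr0 -scalerAl mul1r.
- move=> v w; have := fcomm v w; rewrite /comm /hbar.
  by rewrite scaleN1r mulN1r scaleNr mulNr.
Qed.

Lemma uscalar1_neq0 : upi (UScalar 1) != upi (UScalar 0).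
Proof.
apply/eqP => /upiP /(@ueval_cong {poly K}^o (fun=> 0)) /= e.
have /eqP : (1 : {poly K}^o) = 0.
  rewrite -[LHS](scale1r 1) -[RHS](scale0r 1); apply: e => *.
    by rewrite scaler0 addr0.
  by rewrite /comm mulr0 subrr mulr0 oppr0.
by rewrite oner_eq0.
Qed.

HB.instance Definition _ := GRing.isNzRing.Build Uh
  uaddA uaddC uadd0 uaddN umulA umul1 umulr1 umulDl umulDr uscalar1_neq0.

Lemma uscaleA p q x : uscale p (uscale q x) = uscale (p * q) x.
Proof. by rewrite /uscale umulA -uscalarM. Qed.
Lemma uscaleDr : right_distributive uscale +%R.
Proof. by move=> p x y; rewrite /uscale umulDr. Qed.
Lemma uscaleDl x : {morph uscale^~ x : p q / p + q}.
Proof. by move=> p q; rewrite /uscale uscalarD umulDl. Qed.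

HB.instance Definition _ :=
  GRing.Zmodule_isLmodule.Build {poly K} Uh uscaleA umul1 uscaleDr uscaleDl.

Lemma uscaleAl (p : {poly K}) (x y : Uh) : p *: (x * y) = (p *: x) * y.
Proof. exact: umulA. Qed.
HB.instance Definition _ := GRing.Lmodule_isLalgebra.Build {poly K} Uh uscaleAl.

Lemma uscaleAr (p : {poly K}) (x y : Uh) : p *: (x * y) = x * (p *: y).
Proof. by rewrite uscaleAl {2}/GRing.scale /= {1}/GRing.scale /= /uscale umulC mulrA. Qed.
HB.instance Definition _ := GRing.Lalgebra_isAlgebra.Build {poly K} Uh uscaleAr.

Definition ugen (v : g) : Uh := upi (UGen v).

End Enveloping.

Arguments ugen {K g}.

(** * Quantum moment maps *)

Record quantum_moment_map (K : fieldType) (g : lieAlgebra K)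
    (A : algType {poly K}) (deg : nat -> A -> Prop) (act : g -> A -> A)
    (mu : {lrmorphism Uh g -> A}) : Prop := QuantumMomentMap {
  qmm_flat : flat_module A;
  qmm_grading : grading deg;
  qmm_action : lie_action deg act;
  qmm_deg : forall v, deg 1%N (mu (ugen v));
  (* - hbar^-1 [mu(v), x] = v.x ; by flatness A has no hbar-torsion *)
  qmm_act : forall v x, hbar * act v x = - comm (mu (ugen v)) x }.

(* f : g -> A is the restriction of a quantum moment map Uh g -> A. *)
Definition is_quantum_moment_map (K : fieldType) (g : lieAlgebra K)
    (A : algType {poly K}) (deg : nat -> A -> Prop) (act : g -> A -> A)
    (f : g -> A) : Prop :=
  exists mu : {lrmorphism Uh g -> A},
    (forall v, mu (ugen v) = f v) /\ quantum_moment_map deg act mu.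

(** * Differential operators *)

Definition kend (K : fieldType) (P : comAlgType K) : Type := {linear P -> P}.

HB.instance Definition _ (K : fieldType) (P : comAlgType K) :=
  gen_eqMixin (kend P).
HB.instance Definition _ (K : fieldType) (P : comAlgType K) :=
  gen_choiceMixin (kend P).

Section Kend.
Variables (K : fieldType) (P : comAlgType K).
Implicit Types f g h : kend P.

(* The coercion to functions is lost by the alias [kend]. *)
Definition kapp f : P -> P := (f : {linear P -> P}).

Lemma kendP f g : kapp f =1 kapp g -> f = g.
Proof.
rewrite /kapp; case: f g => [f [[f1] [f2]]] [g [[g1] [g2]]] /= /funext fg.
rewrite fg in f1 f2 *.
by rewrite (Prop_irrelevance f1 g1) (Prop_irrelevance f2 g2).
Qed.

Definition kzero : kend P := \0.
Definition kone : kend P := idfun.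
Definition kadd f g : kend P := kapp f \+ kapp g.
Definition kmul f g : kend P := kapp f \o kapp g.
Definition kopp f : kend P := \- kapp f.
Definition kscale (c : K) f : kend P := c \*: kapp f.

Lemma kaddA : associative kadd.
Proof. by move=> f g h; apply: kendP => x; apply: addrA. Qed.
Lemma kaddC : commutative kadd.
Proof. by move=> f g; apply: kendP => x; apply: addrC. Qed.
Lemma kadd0 : left_id kzero kadd.
Proof. by move=> f; apply: kendP => x; apply: add0r. Qed.
Lemma kaddN : left_inverse kzero kopp kadd.
Proof. by move=> f; apply: kendP => x; apply: addNr. Qed.
Lemma kmulA : associative kmul.
Proof. by move=> f g h; apply: kendP. Qed.
Lemma kmul1 : left_id kone kmul.
Proof. by move=> f; apply: kendP. Qed.
Lemma kmulr1 : right_id kone kmul.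
Proof. by move=> f; apply: kendP. Qed.
Lemma kmulDl : left_distributive kmul kadd.
Proof. by move=> f g h; apply: kendP. Qed.
Lemma kmulDr : right_distributive kmul kadd.
Proof. by move=> f g h; apply: kendP => x; apply: (raddfD f). Qed.
Lemma kone_neq0 : kone != kzero.
Proof.
by apply/eqP => /(congr1 (fun f => kapp f 1))/eqP; rewrite /= oner_eq0.
Qed.

HB.instance Definition _ := GRing.isNzRing.Build (kend P)
  kaddA kaddC kadd0 kaddN kmulA kmul1 kmulr1 kmulDl kmulDr kone_neq0.

Lemma kscaleA c d f : kscale c (kscale d f) = kscale (c * d) f.
Proof. by apply: kendP => x; apply: scalerA. Qed.
Lemma kscale1 : left_id 1 kscale.
Proof. by move=> f; apply: kendP => x; apply: scale1r. Qed.
Lemma kscaleDr : right_distributive kscale +%R.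
Proof. by move=> c f g; apply: kendP => x; apply: scalerDr. Qed.
Lemma kscaleDl f : {morph kscale^~ f : c d / c + d}.
Proof. by move=> c d; apply: kendP => x; apply: scalerDl. Qed.

HB.instance Definition _ :=
  GRing.Zmodule_isLmodule.Build K (kend P) kscaleA kscale1 kscaleDr kscaleDl.

Lemma kscaleAl (c : K) f g : c *: (f * g) = (c *: f) * g.
Proof. by apply: kendP. Qed.
HB.instance Definition _ := GRing.Lmodule_isLalgebra.Build K (kend P) kscaleAl.

Lemma kscaleAr (c : K) f g : c *: (f * g) = f * (c *: g).
Proof. by apply: kendP => x; apply: esym; apply: (linearZ_LR (f : {linear P -> P})). Qed.
HB.instance Definition _ := GRing.Lalgebra_isAlgebra.Build K (kend P) kscaleAr.

(* Multiplication by an element of P *)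
Definition mulop (a : P) : kend P := a \*o idfun.

Lemma mulopM a b : mulop (a * b) = mulop a * mulop b.
Proof. by apply: kendP => x; apply: esym; apply: mulrA. Qed.
Lemma mulopC a b : mulop a * mulop b = mulop b * mulop a.
Proof. by rewrite -!mulopM mulrC. Qed.

(* Differential operators of order at most n, in the sense of Grothendieck:
   the commutators with functions have order at most n - 1, and those of
   negative order are 0. *)
Fixpoint diffop (n : nat) (D : kend P) : Prop :=
  forall a : P,
    if n is m.+1 then diffop m (comm D (mulop a)) else comm D (mulop a) = 0.

Lemma commDl (A : pzRingType) (x y z : A) : comm (x + y) z = comm x z + comm y z.
Proof. by rewrite /comm mulrDl mulrDr opprD addrACA. Qed.
Lemma commMl (A : pzRingType) (x y z : A) : comm (x * y) z = comm x z * y + x * comm y z.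
Proof.
by rewrite /comm [RHS]addrC mulrBl mulrBr !mulrA addrA subrK.
Qed.
Lemma diffop0 n : diffop n 0.
Proof.
have c0 a : comm (0 : kend P) a = 0 by rewrite /comm mul0r mulr0 subrr.
by elim: n => [|n IH] a /=; rewrite c0.
Qed.

Lemma diffop_lin n c D E : diffop n D -> diffop n E -> diffop n (c *: D + E).
Proof.
elim: n D E => [|n IH] D E hD hE a /=.
  by rewrite commDl [comm E _]hE addr0 /comm -scalerAl -scalerAr -scalerBr [_ - _]hD scaler0.
rewrite commDl /comm -scalerAl -scalerAr -scalerBr; apply: IH; [exact: hD | exact: hE].
Qed.

Lemma diffopD n D E : diffop n D -> diffop n E -> diffop n (D + E).
Proof. by rewrite -[D in D + E]scale1r; apply: diffop_lin. Qed.

Lemma diffopZ n c D : diffop n D -> diffop n (c *: D).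
Proof. by move=> hD; rewrite -[_ *: _]addr0; apply: diffop_lin => //; apply: diffop0. Qed.

Lemma diffopN n D : diffop n D -> diffop n (- D).
Proof. by rewrite -scaleN1r; apply: diffopZ. Qed.

Lemma diffopS n D : diffop n D -> diffop n.+1 D.
Proof.
elim: n D => [|n IH] D hD a; last by apply: IH; apply: hD.
by rewrite -/(diffop 0 _) hD; apply: diffop0.
Qed.

Lemma diffop_le m n D : (m <= n)%N -> diffop m D -> diffop n D.
Proof.
by move=> /subnK <- hD; elim: (n - m)%N => [//|k IH]; rewrite addSn; apply: diffopS.
Qed.

Lemma diffop_mulop a : diffop 0 (mulop a).
Proof. by move=> b /=; rewrite /comm mulopC subrr. Qed.

Lemma diffop1 : diffop 0 1.
Proof. by move=> b /=; rewrite /comm mulr1 mul1r subrr. Qed.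

Lemma diffopM m n D E : diffop m D -> diffop n E -> diffop (m + n) (D * E).
Proof.
move: {2}(m + n)%N (leqnn (m + n)) => k.
have base D' E' : diffop 0 D' -> diffop 0 E' -> diffop 0 (D' * E').
  by move=> hD hE a; rewrite commMl hD hE mul0r mulr0 addr0.
elim: k m n D E => [|k IH] [|m] [|n] D E le hD hE //; try exact: base.
- move=> a; rewrite -/(diffop _ _) commMl hD mul0r add0r.
  by apply: (IH 0%N n); [exact: le | exact: hD | exact: hE].
- rewrite addn0 in le *; move=> a; rewrite -/(diffop _ _) commMl hE mulr0 addr0.
  by have := IH m 0%N; rewrite addn0; apply; [exact: le | exact: hD | exact: hE].
- rewrite addSn in le *; move=> a; rewrite -/(diffop _ _) commMl.
  apply: diffopD; first by apply: (IH m n.+1); [exact: le | exact: hD | exact: hE].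
  by move: le; rewrite addnS -addSn => le; apply: (IH m.+1 n); [exact: le | exact: hD | exact: hE].
Qed.

Lemma derivation_diffop (D : kend P) :
  (forall a b, kapp D (a * b) = kapp D a * b + a * kapp D b) -> diffop 1 D.
Proof.
move=> hD a /=.
suff -> : comm D (mulop a) = mulop (kapp D a) by apply: diffop_mulop.
apply: kendP => x; have := hD a x.
by rewrite /comm /kapp /= /kmul /kapp /= => ->; rewrite addrK.
Qed.
End Kend.

(** * The Rees algebra of differential operators

    The subalgebra of polynomials in hbar whose coefficient of hbar^n is a
    differential operator of order at most n. *)

Definition in_rees (K : fieldType) (P : comAlgType K) : {pred {poly kend P}} :=
  fun p => `[< forall n, diffop n p`_n >].
Arguments in_rees {K}.

Section Rees.
Variables (K : fieldType) (P : comAlgType K).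

Lemma in_reesP (p : {poly kend P}) :
  reflect (forall n, diffop n p`_n) (p \in in_rees P).
Proof. exact: asboolP. Qed.

Lemma in_rees_subring : subring_closed (in_rees P).
Proof.
split.
- by apply/in_reesP => -[|n]; rewrite coef1; [apply: diffop1 | apply: diffop0].
- move=> p q /in_reesP hp /in_reesP hq; apply/in_reesP => n; rewrite coefB.
  by apply: diffopD => //; apply: diffopN.
move=> p q /in_reesP hp /in_reesP hq; apply/in_reesP => n; rewrite coefM.
apply: big_ind; [exact: diffop0 | by move=> *; apply: diffopD |].
move=> i _; rewrite -[X in diffop X](@subnKC i n); last by rewrite -ltnS.
exact: diffopM.
Qed.
HB.instance Definition _ := GRing.isSubringClosed.Build _ (in_rees P) in_rees_subring.

Definition rees : Type := {p : {poly kend P} | p \in in_rees P}.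
HB.instance Definition _ := SubChoice.on rees.
HB.instance Definition _ := [SubChoice_isSubNzRing of rees by <:].

Implicit Types (x y : rees) (r : {poly K}).

Definition pscale r (p : {poly kend P}) : {poly kend P} := map_poly (in_alg _) r * p.

Lemma pscale_rees r x : pscale r (val x) \in in_rees P.
Proof.
apply: rpredM; last exact: valP.
apply/in_reesP => n; rewrite coef_map /=.
by apply: diffopZ; apply: (@diffop_le _ _ 0); last apply: diffop1.
Qed.

Definition rees_scale r x : rees := Sub (pscale r (val x)) (pscale_rees r x).

Lemma rees_scaleA r s x : rees_scale r (rees_scale s x) = rees_scale (r * s) x.
Proof. by apply: val_inj; rewrite /= /pscale rmorphM mulrA. Qed.
Lemma rees_scale1 : left_id 1 rees_scale.
Proof. by move=> x; apply: val_inj; rewrite /= /pscale rmorph1 mul1r. Qed.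
Lemma rees_scaleDr : right_distributive rees_scale +%R.
Proof. by move=> r x y; apply: val_inj; rewrite /= /pscale mulrDr. Qed.
Lemma rees_scaleDl x : {morph rees_scale^~ x : r s / r + s}.
Proof. by move=> r s; apply: val_inj; rewrite /= /pscale rmorphD mulrDl. Qed.

HB.instance Definition _ := GRing.Zmodule_isLmodule.Build {poly K} rees
  rees_scaleA rees_scale1 rees_scaleDr rees_scaleDl.

Lemma rees_scaleAl r x y : r *: (x * y) = (r *: x) * y.
Proof. by apply: val_inj; rewrite /= /pscale mulrA. Qed.
HB.instance Definition _ := GRing.Lmodule_isLalgebra.Build {poly K} rees rees_scaleAl.

Lemma pscale_central r p : map_poly (in_alg (kend P)) r * p = p * map_poly (in_alg _) r.
Proof.
apply/polyP => n; rewrite coefM coefMr; apply: eq_bigr => i _.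
by rewrite coef_map /= -scalerAl -scalerAr mul1r mulr1.
Qed.

Lemma rees_scaleAr r x y : r *: (x * y) = x * (r *: y).
Proof.
by apply: val_inj; rewrite /= /pscale pscale_central -mulrA -pscale_central.
Qed.
HB.instance Definition _ := GRing.Lalgebra_isAlgebra.Build {poly K} rees rees_scaleAr.

(* hbar^n D, for D of order at most n *)
Lemma homog_rees n D : diffop n D -> D *: 'X^n \in in_rees P.
Proof.
move=> hD; apply/in_reesP => m; rewrite coefZ coefXn.
by case: eqP => [->|_]; rewrite ?mulr1 // mulr0; apply: diffop0.
Qed.

Definition rees_homog n D (hD : diffop n D) : rees := Sub (D *: 'X^n) (homog_rees hD).

Definition rees_deg (n : nat) (x : rees) : Prop :=
  forall i, i != n -> (val x)`_i = 0.

(* hbar^-1 x, for x in hbar * rees *)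
Definition hbar_div (x : rees) : rees := insubd 0 (drop_poly 1 (val x)).

End Rees.


(** * Quivers *)

Record quiver := Quiver {
  vertex : finType;
  arrow : finType;
  src : arrow -> vertex;
  tgt : arrow -> vertex }.

(** The Lie algebra gl_d *)

Definition gl (K : fieldType) (I : finType) (d : I -> nat) : Type :=
  forall i, 'M[K]_(d i).

HB.instance Definition _ (K : fieldType) (I : finType) (d : I -> nat) :=
  Choice.copy (gl K d) (forall i, 'M[K]_(d i)).

Section Gl.
Variables (K : fieldType) (I : finType) (d : I -> nat).
Implicit Types u v w : gl K d.

Lemma glP v w : (forall i, v i = w i) -> v = w.
Proof. exact: functional_extensionality_dep. Qed.

Definition gl_zero : gl K d := fun i => 0.
Definition gl_add v w : gl K d := fun i => v i + w i.
Definition gl_opp v : gl K d := fun i => - v i.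
Definition gl_scale (c : K) v : gl K d := fun i => c *: v i.

Lemma gl_addA : associative gl_add.
Proof. by move=> u v w; apply: glP => i; apply: addrA. Qed.
Lemma gl_addC : commutative gl_add.
Proof. by move=> u v; apply: glP => i; apply: addrC. Qed.
Lemma gl_add0 : left_id gl_zero gl_add.
Proof. by move=> u; apply: glP => i; apply: add0r. Qed.
Lemma gl_addN : left_inverse gl_zero gl_opp gl_add.
Proof. by move=> u; apply: glP => i; apply: addNr. Qed.
HB.instance Definition _ :=
  GRing.isZmodule.Build (gl K d) gl_addA gl_addC gl_add0 gl_addN.

Lemma gl_scaleA a b v : gl_scale a (gl_scale b v) = gl_scale (a * b) v.
Proof. by apply: glP => i; apply: scalerA. Qed.
Lemma gl_scale1 : left_id 1 gl_scale.
Proof. by move=> v; apply: glP => i; apply: scale1r. Qed.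
Lemma gl_scaleDr : right_distributive gl_scale +%R.
Proof. by move=> a v w; apply: glP => i; apply: scalerDr. Qed.
Lemma gl_scaleDl v : {morph gl_scale^~ v : a b / a + b}.
Proof. by move=> a b; apply: glP => i; apply: scalerDl. Qed.
HB.instance Definition _ := GRing.Zmodule_isLmodule.Build K (gl K d)
  gl_scaleA gl_scale1 gl_scaleDr gl_scaleDl.

Definition gl_bracket v w : gl K d := fun i => v i *m w i - w i *m v i.

Lemma gl_linearl w : linear (gl_bracket^~ w).
Proof.
move=> c u v; apply: glP => i; rewrite /gl_bracket.
rewrite [(c *: u + v) i](_ : _ = c *: u i + v i) //.
rewrite [RHS](_ : _ = c *: (u i *m w i - w i *m u i) + (v i *m w i - w i *m v i)) //.
by rewrite mulmxDl mulmxDr -scalemxAl -scalemxAr opprD addrACA scalerBr.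
Qed.

Lemma gl_bracketC v w : gl_bracket v w = - gl_bracket w v.
Proof. by apply: glP => i; apply: esym; apply: opprB. Qed.

Lemma gl_linearr v : linear (gl_bracket v).
Proof.
move=> c u w; rewrite gl_bracketC gl_linearl opprD -scalerN.
by rewrite -!gl_bracketC.
Qed.

Lemma gl_alternating v : gl_bracket v v = 0.
Proof. by apply: glP => i; apply: subrr. Qed.

Lemma gl_jacobi u v w :
  gl_bracket u (gl_bracket v w) + gl_bracket v (gl_bracket w u)
    + gl_bracket w (gl_bracket u v) = 0.
Proof.
apply: glP => i.
pose b (x y : 'M[K]_(d i)) := x *m y - y *m x.
rewrite [LHS](_ : _ = b (u i) (b (v i) (w i)) + b (v i) (b (w i) (u i))
   + b (w i) (b (u i) (v i))) // [RHS](_ : _ = 0) // /b.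
rewrite !(mulmxBl, mulmxBr) !mulmxA !opprB !addrA.
rewrite [LHS](ACl ((1*12)*(2*7)*(3*10)*(4*5)*(6*11)*(8*9)))/=.
by rewrite !(subrr, addNr, add0r).
Qed.

Definition gl_lie : lieAlgebra K :=
  LieAlgebra gl_linearl gl_linearr gl_alternating gl_jacobi.

End Gl.

Section QuiverOperators.
Variables (K : fieldType) (Q : quiver) (d : vertex Q -> nat).

Definition coord : Type := {a : arrow Q & ('I_(d (tgt a)) * 'I_(d (src a)))%type}.

(* The algebra of functions on Rep^Q_d *)
Definition Rep : comAlgType K := {mpoly K[#|{: coord}|]}.

Definition var (a : arrow Q) (p : 'I_(d (tgt a))) (q : 'I_(d (src a))) :
    'I_#|{: coord}| :=
  enum_rank (Tagged (fun a => ('I_(d (tgt a)) * 'I_(d (src a)))%type) (p, q) : coord).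

Definition Dh : algType {poly K} := rees Rep.

Definition partial (i : 'I_#|{: coord}|) : kend Rep := mderiv i.

Lemma partial_diffop i : diffop 1 (partial i).
Proof. by apply: derivation_diffop => a b; apply: mderivM. Qed.

(* (a)_{p,q}, in degree 0 *)
Definition coordop a p q : Dh := rees_homog (diffop_mulop ('X_(@var a p q) : Rep)).
(* hbar times the partial derivative along (a)_{p,q}, in degree 1 *)
Definition partialop a p q : Dh := rees_homog (partial_diffop (@var a p q)).

Definition arrow_mx a : 'M[Dh]_(d (tgt a), d (src a)) :=
  \matrix_(p, q) coordop p q.
Definition coarrow_mx a : 'M[Dh]_(d (src a), d (tgt a)) :=
  \matrix_(p, q) partialop q p.

(* [conform_mx 0] only transports matrices along the equality of vertices in the
   condition of the sum. *)
Definition moment_mx (i : vertex Q) : 'M[Dh]_(d i) :=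
  \sum_(a | tgt a == i) conform_mx 0 (arrow_mx a *m coarrow_mx a)
  - \sum_(a | src a == i) conform_mx 0 (coarrow_mx a *m arrow_mx a).

(* Entry (p, q) of the i-th block is tau(e^i_{p,q}). *)
Definition tau_mx (i : vertex Q) : 'M[Dh]_(d i) :=
  \sum_(a | src a == i) conform_mx 0
    (\matrix_(p < d (src a), q < d (src a))
       \sum_(j < d (tgt a)) coordop j p * partialop j q)
  - \sum_(a | tgt a == i) conform_mx 0
    (\matrix_(p < d (tgt a), q < d (tgt a))
       \sum_(j < d (src a)) coordop q j * partialop p j).

Definition tau (v : gl_lie K d) : Dh :=
  \sum_i \sum_p \sum_q cst (v i p q) * tau_mx i p q.

Definition Dh_act (v : gl_lie K d) (x : Dh) : Dh := hbar_div (comm (tau v) x).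

(* tr(M v), for M block-diagonal with entries in Dh *)
Definition trace_pairing (M : forall i, 'M[Dh]_(d i)) (v : gl_lie K d) : Dh :=
  \sum_i \tr (M i *m map_mx cst ((v : gl K d) i)).

(* The block-diagonal matrix I_i *)
Definition idblock (i j : vertex Q) : 'M[Dh]_(d j) :=
  if j == i then 1%:M else 0.

End QuiverOperators.

(* Main.v *)
Require Import Defs.
From HB Require Import structures.
From mathcomp Require Import all_boot all_algebra.
From mathcomp Require Import boolp mpoly.

Set Implicit Arguments.
Unset Strict Implicit.
Unset Printing Implicit Defensive.

Import GRing.Theory.
Local Open Scope ring_scope.

(** Both maps have the form [f v = hbar * cst (l v) - tau v], where [l] is a linear
    form on [gl_d] that vanishes on brackets. The term [hbar * cst (l v)] is
    central, so [- [f v, x] = [tau v, x]], and this is [hbar] times the action of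
    [v] on [x] by the very definition of that action. What is left to
    prove is that [f] extends to the homogenized enveloping algebra, and that the
    algebra of differential operators and the action are as the definition of a
    quantum moment map requires. All of this comes from three facts.

    - The commutation relation [[tau v, tau w] = hbar * tau [v, w]]
      ([tau_bracket]). The coefficient of [hbar] in [tau v] is a vector field
      [gl_field v], that is, a derivation of the polynomial functions. If [X] is
      the matrix of coordinates along an arrow [a], then this field sends [X] to
      [X v_(s a) - v_(t a) X]: it is the infinitesimal conjugation. A commutator
      of derivations is a derivation, and a derivation of a polynomial algebra is
      determined by its values on the variables, so the relation reduces to one
      identity between products of three matrices ([mulmx_bracket]).
    - The trace formula ([trace_moment]). Let [Y] be the matrix of derivations
      dual to [X]; the moment matrix is made of the products [X Y] and [- Y X].
      The entries of [X Y] have the derivations on the right, as in [tau]. Those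
      of [Y X] do not, and moving the derivations to the right adds
      [hbar * d_(t a)] on the diagonal. Hence the trace of the moment matrix
      against [v] is [- tau v - hbar * sum_a d_(t a) tr v_(s a)]. The correction
      is a combination of traces, so it vanishes on brackets, and adding
      [hbar * sum_i r_i I_i] to the moment matrix adds another combination of
      traces ([trace_identity]).
    - The Rees algebra is torsion-free over [K[hbar]], hence flat because
      [K[hbar]] is a principal ideal domain ([torsion_free_flat]). Cancelling
      [hbar] turns identities for commutators into the axioms of an action: the
      Leibniz rule for commutators gives the one for the action, and the Jacobi
      identity gives compatibility with brackets ([inner_lie_action]). The
      division by [hbar] in the definition of the action is exact because the
      commutator with a derivation does not raise the order of a differential
      operator ([diffop_comm_derivation]). *)

(** * Torsion-free modules over a polynomial ring in one variable *)

Lemma poly_bezout (K : fieldType) n (r : 'I_n -> {poly K}) :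
  exists (u s : 'I_n -> {poly K}) g,
    g = \sum_i r i * u i /\ forall i, r i = g * s i.
Proof.
elim: n r => [|n IH] r.
  by exists (fun=> 0), (fun=> 0), 0; split; [rewrite big_ord0 | case].
have [u [s [g [gE rE]]]] := IH (fun i => r (lift ord0 i)).
have [[a b] /= /eqpf_eq [c c0 abE]] := Bezoutp (r ord0) g.
set h := gcdp (r ord0) g in abE.
(* [Bezoutp] gives the gcd only up to the nonzero constant [c]. *)
have hE : h = r ord0 * (c^-1 *: a) + g * (c^-1 *: b).
  rewrite -!scalerAr -scalerDr ![_ * a]mulrC ![_ * b]mulrC.
  by rewrite abE scalerA mulVf // scale1r.
exists (fun i => if unlift ord0 i is Some j then u j * (c^-1 *: b) else c^-1 *: a).
exists (fun i => if unlift ord0 i is Some j then (g %/ h) * s j else r ord0 %/ h).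
exists h; split.
  rewrite big_ord_recl unlift_none hE gE mulr_suml; congr (_ + _).
  by apply: eq_bigr => i _; rewrite liftK mulrA.
move=> i; case: unliftP => [j ->|->].
  by rewrite mulrA [h * _]mulrC divpK ?dvdp_gcdr // -rE.
by rewrite mulrC divpK ?dvdp_gcdl.
Qed.

(** Write a relation [sum_i r_i x_i = 0] as [g * sum_i s_i x_i = 0], where
    [g = sum_i r_i u_i] is the gcd of the [r_i]. If [g] is nonzero, then
    [sum_i s_i x_i = 0] by torsion-freeness, and [sum_i u_i s_i = 1]. So
    [x_i = x_i - u_i * sum_j s_j x_j] for all [i], and the matrix
    [1 - u s^T] of this system kills the row [r]. *)
Lemma torsion_free_flat (K : fieldType) (M : lmodType {poly K}) :
  (forall (p : {poly K}) (x : M), p *: x = 0 -> p != 0 -> x = 0) ->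
  flat_module M.
Proof.
move=> tf n r x rx0.
have [u [s [g [gE rE]]]] := poly_bezout (r 0).
have [g0|g0] := eqVneq g 0.
  have r0 : r = 0 by apply/rowP => i; rewrite rE g0 mul0r mxE.
  exists n, 1%:M, x; rewrite r0 mul0mx; split=> // i.
  rewrite (bigD1 i) //= mxE eqxx scale1r big1 ?addr0 // => j.
  by rewrite mxE eq_sym => /negPf->; rewrite scale0r.
have sx0 : \sum_i s i *: x i = 0.
  apply: (tf g) => //; rewrite scaler_sumr -[RHS]rx0.
  by apply: eq_bigr => i _; rewrite scalerA -rE.
exists n, (\matrix_(i, j) ((i == j)%:R - u i * s j)), x; split.
  apply/rowP => j; rewrite !mxE.
  under eq_bigr do rewrite mxE mulrBr mulrA.
  rewrite sumrB -mulr_suml -gE -rE (bigD1 j) //= eqxx mulr1 big1 ?addr0 ?subrr //.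
  by move=> i /negPf->; rewrite mulr0.
move=> i; under eq_bigr do rewrite mxE scalerBl -scalerA.
rewrite sumrB -scaler_sumr sx0 scaler0 subr0 (bigD1 i) //= eqxx scale1r.
by rewrite big1 ?addr0 // => j; rewrite eq_sym => /negPf->; rewrite scale0r.
Qed.

(** * The Rees algebra as a graded module over the polynomials in hbar *)

Section ReesAlgebra.
Variables (K : fieldType) (P : comAlgType K).
Implicit Types (x y : rees P) (p : {poly K}).

Lemma val_scale p x : val (p *: x) = map_poly (in_alg (kend P)) p * val x.
Proof. by []. Qed.

(** Operators form a noncommutative ring that may have zero divisors, but the leading
    coefficient of the scalar [p] is an invertible scalar, so it does not kill the
    leading coefficient of [x]. *)
Lemma rees_torsion_free p x : p *: x = 0 -> p != 0 -> x = 0.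
Proof.
move=> /(congr1 val); rewrite val_scale => px0 p0; apply: val_inj.
apply/eqP; rewrite -lead_coef_eq0.
have := mul_lead_coef (map_poly (in_alg (kend P)) p) (val x).
rewrite px0 coef0 lead_coef_map_id0 /=; last 2 first.
- exact: scale0r.
- by rewrite scaler_eq0 oner_eq0 orbF lead_coef_eq0.
by rewrite -scalerAl mul1r => /eqP; rewrite scaler_eq0 !lead_coef_eq0 (negPf p0).
Qed.

Lemma rees_flat : flat_module (rees P).
Proof. exact/torsion_free_flat/rees_torsion_free. Qed.

Lemma val_hbar : val (hbar : rees P) = 'X.
Proof. by rewrite val_scale mulr1 map_polyX. Qed.

Lemma coef_scaleC (c : K) x i : (val (c%:P *: x))`_i = c *: (val x)`_i.
Proof. by rewrite val_scale map_polyC coefCM /= -scalerAl mul1r. Qed.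

Lemma coef_hbar x i : (val (hbar * x))`_i = if i is j.+1 then (val x)`_j else 0.
Proof.
rewrite [val _](_ : _ = val (hbar : rees P) * val x) // val_hbar coefXM.
by case: i.
Qed.

Lemma rees_hbar_inj : injective (fun x => hbar * x).
Proof.
move=> x y /= e; apply/val_inj/polyP => i.
by have := congr1 (fun z : rees P => (val z)`_i.+1) e; rewrite !coef_hbar.
Qed.

Lemma rees_deg_hbar n x : rees_deg n.+1 (hbar * x) -> rees_deg n x.
Proof. by move=> h i ni; have := h i.+1; rewrite coef_hbar; apply. Qed.

Lemma coef_sum_rees N (c : 'I_N -> rees P) i :
  (val (\sum_(j < N) c j))`_i = \sum_(j < N) (val (c j))`_i.
Proof. by rewrite [val _]raddf_sum coef_sum. Qed.

Lemma rees_grading : grading (@rees_deg K P).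
Proof.
split.
- move=> n c x y hx hy i ni.
  by rewrite [val _]raddfD coefD coef_scaleC hx // hy // scaler0 addr0.
- by move=> i i0; rewrite coef1 (negPf i0).
- move=> m n x y hx hy i imn; rewrite [val _]rmorphM coefM big1 // => j _.
  have [jm|jm] := eqVneq (j : nat) m; last by rewrite hx ?mul0r.
  rewrite hy ?mulr0 //; apply: contraNneq imn => <-.
  by rewrite -jm subnKC // -ltnS.
- by move=> i i1; rewrite val_hbar coefX (negPf i1).
- move=> x; exists (size (val x)).
  exists (fun i => rees_homog (in_reesP _ (valP x) i)); split.
    by move=> i j ji; rewrite coefZ coefXn (negPf ji) mulr0.
  apply/val_inj/polyP => i; rewrite coef_sum_rees.
  under eq_bigr do rewrite coefZ coefXn.
  have [li|li] := ltnP i (size (val x)).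
    rewrite (bigD1 (Ordinal li)) //= eqxx mulr1 big1 ?addr0 // => j.
    by rewrite -val_eqE /= eq_sym => /negPf->; rewrite mulr0.
  rewrite nth_default // big1 // => j _; rewrite gtn_eqF ?mulr0 //.
  exact: leq_trans li.
- move=> N c hc c0 i iN; apply/val_inj/polyP => j.
  have [->|ji] := eqVneq j i; last by rewrite hc // coef0.
  have := congr1 (fun z : rees P => (val z)`_i) c0; rewrite coef_sum_rees.
  rewrite (bigD1 (Ordinal iN)) //= big1 ?addr0 // => k.
  by rewrite -val_eqE eq_sym /= => ki; apply: hc.
Qed.

Lemma rees_deg1P x : rees_deg 1 x -> val x = (val x)`_1 *: 'X.
Proof.
move=> hx; apply/polyP => i; rewrite coefZ coefX.
by have [->|i1] := eqVneq i 1%N; rewrite ?mulr1 // mulr0 hx.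
Qed.

End ReesAlgebra.

(** * The universal property of the homogenized enveloping algebra *)

Section Lift.
Variables (K : fieldType) (g : lieAlgebra K) (A : algType {poly K}) (f : g -> A).
Hypothesis flin : forall (c : K) v w, f (c *: v + w) = c%:P *: f v + f w.
Hypothesis fcomm : forall v w, comm (f v) (f w) = - (hbar * f (lie_bracket v w)).

Definition ulift (x : Uh g) : A := ueval f (repr x).

Lemma ulift_upi e : ulift (upi e) = ueval f e.
Proof. exact: (ueval_cong flin fcomm (ucong_repr e)). Qed.

Lemma ulift_zmod : zmod_morphism ulift.
Proof.
move=> x y; case: (upi_surj x) (upi_surj y) => {}x -> [{}y ->].
have -> : upi x - upi y = upi (UAdd x (UMul (UScalar (-1)) y)) :> Uh g.
  by rewrite -uaddE -umulE.
by rewrite !ulift_upi /= scaleN1r mulN1r.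
Qed.

Lemma ulift_monoid : monoid_morphism ulift.
Proof.
split; first by rewrite [1](_ : _ = upi (UScalar 1)) // ulift_upi /= scale1r.
move=> x y; case: (upi_surj x) (upi_surj y) => {}x -> [{}y ->].
by rewrite [_ * _ in LHS](umulE x y) !ulift_upi.
Qed.

Lemma ulift_scalable : scalable ulift.
Proof.
move=> p x; case: (upi_surj x) => {}x ->.
by rewrite [_ *: _ in LHS](umulE (UScalar p) x) !ulift_upi /= -scalerAl mul1r.
Qed.

HB.instance Definition _ := GRing.isZmodMorphism.Build _ _ ulift ulift_zmod.
HB.instance Definition _ := GRing.isMonoidMorphism.Build _ _ ulift ulift_monoid.
HB.instance Definition _ := GRing.isScalable.Build _ _ _ _ ulift ulift_scalable.

Lemma enveloping_lift : exists mu : {lrmorphism Uh g -> A}, forall v, mu (ugen v) = f v.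
Proof. by exists ulift => v; rewrite /= ulift_upi. Qed.

End Lift.

(** * Actions given by commutators *)

Section Commutators.
Variable A : pzRingType.
Implicit Types x y z : A.

Lemma commC x y : comm x y = - comm y x.
Proof. by rewrite /comm opprB. Qed.

Lemma commBl x y z : comm (x - y) z = comm x z - comm y z.
Proof. by rewrite /comm mulrBl mulrBr !opprB addrACA [RHS]addrACA [- _ - _]addrC. Qed.

Lemma commBr x y z : comm z (x - y) = comm z x - comm z y.
Proof. by rewrite [LHS]commC commBl opprB [comm z x]commC [comm z y]commC opprK addrC. Qed.

Lemma commMr x y z : comm x (y * z) = comm x y * z + y * comm x z.
Proof. by rewrite [LHS]commC commMl opprD -mulNr -mulrN -!commC addrC. Qed.

Lemma comm_jacobi x y z :
  comm (comm x y) z = comm x (comm y z) - comm y (comm x z).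
Proof.
rewrite [comm y z]/comm commBr !commMr [comm (comm x y) z]/comm [comm y (comm x z)]/comm.
by rewrite opprD opprB !addrA [RHS](ACl (1*4*(2*6)*(5*3)))/= !subrr !addr0.
Qed.
End Commutators.

Section InnerAction.
Variables (K : fieldType) (g : lieAlgebra K) (A : algType {poly K}).
Variables (deg : nat -> A -> Prop) (act : g -> A -> A) (tau : g -> A).
Hypothesis grA : grading deg.
Hypothesis hbar_inj : injective (fun x : A => hbar * x).
Hypothesis deg_hbarV : forall n (x : A), deg n.+1 (hbar * x) -> deg n x.
Hypothesis tau_lin : forall (c : K) v w, tau (c *: v + w) = c%:P *: tau v + tau w.
Hypothesis tau_deg : forall v, deg 1 (tau v).
Hypothesis tau_comm : forall v w, comm (tau v) (tau w) = hbar * tau (lie_bracket v w).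
Hypothesis act_tau : forall v x, hbar * act v x = comm (tau v) x.

Lemma hbarE (x : A) : hbar * x = 'X *: x.
Proof. by rewrite /hbar -scalerAl mul1r. Qed.

Lemma commZl (p : {poly K}) (x y : A) : comm (p *: x) y = p *: comm x y.
Proof. by rewrite /comm -scalerAl -scalerAr scalerBr. Qed.

Lemma commZr (p : {poly K}) (x y : A) : comm x (p *: y) = p *: comm x y.
Proof. by rewrite /comm -scalerAl -scalerAr scalerBr. Qed.

Lemma comm_scalar (p : {poly K}) (x : A) : comm p%:A x = 0.
Proof. by rewrite commZl /comm mul1r mulr1 subrr scaler0. Qed.

Lemma deg_opp n x : deg n x -> deg n (- x).
Proof.
move=> hx; have := deg_linear grA (-2%:R) hx hx.
by rewrite polyCN scaleNr polyC_natr scaler_nat mulr2n opprD subrK.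
Qed.

Lemma deg_add n x y : deg n x -> deg n y -> deg n (x + y).
Proof. by move=> hx hy; have := deg_linear grA 1 hx hy; rewrite scale1r. Qed.

Lemma deg_cst (c : K) : deg 0 (cst c).
Proof.
have h1 := deg_one grA; have := deg_linear grA (c - 1) h1 h1.
by rewrite polyCB scalerBl scale1r subrK.
Qed.

(** After multiplication by [hbar], or by its square for the bracket axiom, each
    algebraic axiom is a property of commutators. *)
Lemma inner_lie_action : lie_action deg act.
Proof.
split.
- move=> c v w x; apply: hbar_inj.
  by rewrite mulrDr -scalerAr !act_tau tau_lin commDl commZl.
- move=> v p x y; apply: hbar_inj.
  by rewrite mulrDr -scalerAr !act_tau commC commDl commZl opprD -scalerN -!commC.
- move=> v x y; apply: hbar_inj.
  by rewrite mulrDr mulrA !hbarE scalerAr -!hbarE !act_tau commMr.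
- move=> v w x; apply/hbar_inj/hbar_inj => /=.
  have -> y z : hbar * (hbar * (y - z)) = hbar * (hbar * y) - hbar * (hbar * z).
    by rewrite !mulrBr.
  rewrite !act_tau !hbarE -[LHS]commZl -!commZr -!hbarE.
  by rewrite !act_tau -tau_comm comm_jacobi.
- move=> n v x hx; apply: deg_hbarV; rewrite act_tau /comm.
  apply: deg_add; first by rewrite -add1n; apply: (deg_mul grA).
  by apply: deg_opp; rewrite -addn1; apply: (deg_mul grA).
Qed.

(** The term [hbar * cst (l v)] is central, so it changes no commutator, and [l]
    kills brackets, so the relations of the enveloping algebra hold as they do for
    [- tau]. *)
Lemma inner_quantum_moment_map (l : g -> K) (f : g -> A) :
  flat_module A ->
  (forall (c : K) v w, l (c *: v + w) = c * l v + l w) ->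
  (forall v w, l (lie_bracket v w) = 0) ->
  (forall v, f v = hbar * cst (l v) - tau v) ->
  is_quantum_moment_map deg act f.
Proof.
move=> flatA l_lin l_bracket fE.
have comm_f v x : comm (f v) x = - comm (tau v) x.
  by rewrite fE hbarE commBl commZl comm_scalar scaler0 sub0r.
have f_lin (c : K) v w : f (c *: v + w) = c%:P *: f v + f w.
  rewrite !fE l_lin tau_lin /cst polyCD polyCM scalerDl -scalerA mulrDr -scalerAr.
  by rewrite scalerBr opprD addrACA.
have f_comm v w : comm (f v) (f w) = - (hbar * f (lie_bracket v w)).
  rewrite comm_f commC opprK comm_f commC opprK tau_comm fE l_bracket.
  by rewrite /cst scale0r mulr0 sub0r mulrN opprK.
have [mu muE] := enveloping_lift f_lin f_comm.
exists mu; split=> //; split=> //; first exact: inner_lie_action.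
  move=> v; rewrite muE fE; apply: deg_add; last exact/deg_opp/tau_deg.
  by rewrite -[1%N]addn0; apply: (deg_mul grA) (deg_hbar grA) (deg_cst _).
by move=> v x; rewrite muE comm_f opprK act_tau.
Qed.

End InnerAction.

(** * Derivations as differential operators *)

Section Derivations.
Variables (K : fieldType) (P : comAlgType K).
Implicit Types D E : kend P.

Definition derivation D :=
  forall a b : P, kapp D (a * b) = kapp D a * b + a * kapp D b.

Lemma kappD D E a : kapp (D + E) a = kapp D a + kapp E a.
Proof. by []. Qed.

Lemma kappZ (c : K) D a : kapp (c *: D) a = c *: kapp D a.
Proof. by []. Qed.

Lemma kapp_comm D E a : kapp (comm D E) a = kapp D (kapp E a) - kapp E (kapp D a).
Proof. by []. Qed.

Lemma kapp_lin D (c : K) a b : kapp D (c *: a + b) = c *: kapp D a + kapp D b.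
Proof. exact: linearP. Qed.

Lemma kapp_sum I (r : seq I) (p : pred I) (F : I -> kend P) a :
  kapp (\sum_(i <- r | p i) F i) a = \sum_(i <- r | p i) kapp (F i) a.
Proof. by elim/big_rec2: _ => // i x y _ <-. Qed.

Lemma derivationD D E : derivation D -> derivation E -> derivation (D + E).
Proof. by move=> hD hE a b; rewrite !kappD hD hE mulrDl mulrDr addrACA. Qed.

Lemma derivationZ (c : K) D : derivation D -> derivation (c *: D).
Proof. by move=> hD a b; rewrite !kappZ hD scalerDr scalerAl scalerAr. Qed.

Lemma derivation0 : derivation (0 : kend P).
Proof. by move=> a b; rewrite /kapp /= mul0r mulr0 addr0. Qed.

Lemma derivation_mulop a D : derivation D -> derivation (mulop a * D).
Proof.
move=> hD x y; have := hD x y; rewrite /kapp /= /kmul /kapp /= => ->.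
by rewrite mulrDr mulrA mulrCA.
Qed.

Lemma mulopB (a b : P) : mulop (a - b) = mulop a - mulop b :> kend P.
Proof. by apply: kendP => x; apply: mulrBl. Qed.

(** This reformulation as a commutation relation gives closure of derivations
    under commutators from the Jacobi identity alone. *)
Lemma derivation_commP D :
  derivation D <-> forall a, comm D (mulop a) = mulop (kapp D a).
Proof.
split=> [hD a|hD a b].
  by apply: kendP => x; rewrite kapp_comm hD addrK.
by rewrite -[kapp D a * b](_ : kapp (mulop (kapp D a)) b = _) // -hD kapp_comm subrK.
Qed.

Lemma comm_derivation D E : derivation D -> derivation E -> derivation (comm D E).
Proof.
move=> /derivation_commP hD /derivation_commP hE; apply/derivation_commP => a.
by rewrite comm_jacobi !(hD, hE) kapp_comm mulopB.
Qed.

(** By induction on [n], with the Jacobi identity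
    [[[D, E], a] = [D, [E, a]] - [E, D a]]: both terms on the right have order at
    most [n - 1]. *)
Lemma diffop_comm_derivation D n E :
  derivation D -> diffop n E -> diffop n (comm D E).
Proof.
move=> hD; elim: n E => [|n IH] E hE a /=; rewrite comm_jacobi.
  rewrite (derivation_commP D).1 // [comm E (mulop a)]hE hE.
  by rewrite /comm !mulr0 !mul0r !subrr.
apply: diffopD; first by apply: IH; apply: hE.
by apply: diffopN; rewrite (derivation_commP D).1 //; apply: hE.
Qed.

(** [hbar_div] returns [0] when the quotient leaves the Rees algebra; the
    hypotheses say that it does not. *)
Lemma rees_hbar_divK (x : rees P) :
  (val x)`_0 = 0 -> (forall n, diffop n (val x)`_n.+1) -> hbar * hbar_div x = x.
Proof.
move=> x0 hx; have h : drop_poly 1 (val x) \in in_rees P.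
  by apply/in_reesP => n; rewrite coef_drop_poly addn1.
apply/val_inj/polyP => -[|i]; rewrite coef_hbar ?x0 //.
by rewrite /hbar_div /insubd insubT /= coef_drop_poly addn1.
Qed.

Lemma comm_hbar_divK (t x : rees P) :
  rees_deg 1 t -> derivation (val t)`_1 -> hbar * hbar_div (comm t x) = comm t x.
Proof.
move=> t1 ht.
have cE : val (comm t x) = val t * val x - val x * val t by [].
have tE : val t = ((val t)`_1)%:P * 'X by rewrite mul_polyC -rees_deg1P.
apply: rees_hbar_divK => [|n].
  by rewrite cE tE mulrA -mulrA coefB coefMX coefCM coefXM mulr0 subrr.
rewrite cE tE mulrA -[_%:P * 'X * _]mulrA coefB coefMX coefCM coefXM coefMC.
by apply: diffop_comm_derivation => //; apply/in_reesP/valP.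
Qed.

Lemma comm_rees_deg1 (t u w : rees P) :
  rees_deg 1 t -> rees_deg 1 u -> rees_deg 1 w ->
  comm (val t)`_1 (val u)`_1 = (val w)`_1 -> comm t u = hbar * w.
Proof.
move=> t1 u1 w1 tuw; apply: val_inj.
rewrite [LHS](_ : _ = val t * val u - val u * val t) //.
rewrite [RHS](_ : _ = val (hbar : rees P) * val w) // val_hbar.
rewrite (rees_deg1P t1) (rees_deg1P u1) (rees_deg1P w1) -tuw -!mul_polyC.
have XX (c e : kend P) : c%:P * 'X * (e%:P * 'X) = (c * e)%:P * ('X * 'X).
  by rewrite mulrA -[_ * 'X * _]mulrA -commr_polyX mulrA -polyCM mulrA.
by rewrite !XX -[RHS]commr_polyX -[RHS]mulrA -mulrBl -polyCB.
Qed.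

End Derivations.

(** By the Leibniz rule, derivations that agree on two factors agree on the
    product, and they agree on [1], where they vanish. *)
Lemma derivation_eq (K : fieldType) n (D E : kend {mpoly K[n]}) :
  derivation D -> derivation E -> (forall i, kapp D 'X_i = kapp E 'X_i) -> D = E.
Proof.
move=> hD hE DE; apply: kendP.
have one F : derivation F -> kapp F (1 : {mpoly K[n]}) = 0.
  move=> hF; apply: (addrI (kapp F 1)); rewrite addr0.
  by have := hF 1 1; rewrite !mulr1 mul1r => <-.
have DEM a b : kapp D a = kapp E a -> kapp D b = kapp E b ->
    kapp D (a * b) = kapp E (a * b).
  by move=> ea eb; rewrite hD hE ea eb.
have DE1 : kapp D 1 = kapp E 1 by rewrite !one.
elim/mpolyind => [|c m p _ _ IH].
  by rewrite /kapp !linear0.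
rewrite !kapp_lin IH mpolyXE_id; congr (_ *: _ + _).
elim/big_ind: _ => // i _; elim: (m i) => [|k IHk]; rewrite ?expr0 // exprS.
exact: DEM.
Qed.

(** * Vector fields of infinitesimal conjugation *)

Lemma subr_swap_cross (V : zmodType) (a b c e f h : V) :
  a - b - (c - e) - (f - c - (b - h)) = a - f - (h - e).
Proof.
rewrite !opprB !addrA.
by rewrite [LHS](ACl (1*8*3*6*(5*2)*(7*4)))/= !subrr !addr0.
Qed.

(** The linear maps [X -> X V - S X] have the same brackets as the pairs [(V, S)],
    in the opposite order: the mixed terms [S X W] and [T X V] occur twice and
    cancel. *)
Lemma mulmx_bracket (R : pzRingType) m n (X : 'M[R]_(m, n))
    (V W : 'M[R]_n) (S T : 'M[R]_m) :
  (X *m V - S *m X) *m W - T *m (X *m V - S *m X)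
  - ((X *m W - T *m X) *m V - S *m (X *m W - T *m X))
  = X *m (V *m W - W *m V) - (S *m T - T *m S) *m X.
Proof. by rewrite !(mulmxBl, mulmxBr) !mulmxA; apply: subr_swap_cross. Qed.

Section QuiverMomentMap.
Variables (K : fieldType) (Q : quiver) (d : vertex Q -> nat).
Notation Rep := (Rep K d).
Notation Dh := (Dh K d).
Implicit Types (a b : arrow Q) (v w : gl_lie K d).

(** The matrices of the arrows meeting the vertex [i] have index types [d (h a)],
    equal to [d i] only up to the equality [h a = i]. Summing over [i] first makes
    that equality disappear, because each arrow contributes at the single vertex
    [h a]. *)
Lemma sum_conform_mx (T : nmodType) (V : zmodType) (h : arrow Q -> vertex Q)
    (F : forall i, 'M[V]_(d i) -> T) (M : forall a, 'M[V]_(d (h a))) :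
  \sum_i \sum_(a | h a == i) F i (conform_mx 0 (M a)) = \sum_a F (h a) (M a).
Proof.
rewrite (exchange_big_dep predT) //=; apply: eq_bigr => a _.
by rewrite (big_pred1 (h a)) ?conform_mx_id // => i; rewrite eq_sym.
Qed.

Lemma sum_arrow_blocks (T V : zmodType) (h k : arrow Q -> vertex Q)
    (F : forall i, {additive 'M[V]_(d i) -> T})
    (M : forall a, 'M[V]_(d (h a))) (N : forall a, 'M[V]_(d (k a))) :
  \sum_i F i (\sum_(a | h a == i) conform_mx 0 (M a)
              - \sum_(a | k a == i) conform_mx 0 (N a))
  = \sum_a F (h a) (M a) - \sum_a F (k a) (N a).
Proof.
under eq_bigr do rewrite (raddfB (F _)) !(raddf_sum (F _)).
by rewrite sumrB; congr (_ - _); apply: (sum_conform_mx (fun i => F i)).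
Qed.

Lemma cst_lin (c x y : K) : cst (c * x + y) = c%:P *: cst x + cst y :> Dh.
Proof. by rewrite /cst polyCD polyCM scalerDl scalerA. Qed.

Lemma cst_zmod : zmod_morphism (@cst K Dh).
Proof. by move=> x y; rewrite /cst polyCB scalerBl. Qed.
HB.instance Definition _ := GRing.isZmodMorphism.Build _ _ (@cst K Dh) cst_zmod.

Lemma cst_mul (c : K) (x : Dh) : cst c * x = c%:P *: x.
Proof. by rewrite /cst -scalerAl mul1r. Qed.

Lemma mul_cst (c : K) (x : Dh) : x * cst c = c%:P *: x.
Proof. by rewrite /cst -scalerAr mulr1. Qed.

Lemma cstM (x y : K) : cst (x * y) = cst x * cst y :> Dh.
Proof. by rewrite cst_mul /cst polyCM scalerA. Qed.

(** Coefficient of [hbar] in the part of [tau] that comes from the source of [a]: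
    the vector field [X -> X m] on the matrices [X] of coordinates along [a]. *)
Definition source_field a (m : 'M[K]_(d (src a))) : kend Rep :=
  \sum_p \sum_q m p q *: \sum_j mulop ('X_(var j p) : Rep) * partial K (var j q).

(** The vector field [X -> m X]. *)
Definition target_field a (m : 'M[K]_(d (tgt a))) : kend Rep :=
  \sum_p \sum_q m p q *: \sum_j mulop ('X_(var q j) : Rep) * partial K (var p j).

Definition gl_field v : kend Rep :=
  \sum_a source_field (v (src a)) - \sum_a target_field (v (tgt a)).

Lemma val_coord_partial a b p q p' q' :
  val (coordop K p q * partialop K p' q' : Dh)
  = (mulop ('X_(@var Q d a p q) : Rep) * partial K (@var Q d b p' q')) *: 'X.
Proof.
rewrite [LHS](_ : _ = val (coordop K p q : Dh) * val (partialop K p' q' : Dh)) //.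
by rewrite /= expr0 -!mul_polyC mulr1 mulrA polyCM.
Qed.

Lemma kapp_partialX i k : kapp (partial K i) 'X_k = (i == k)%:R :> Rep.
Proof.
rewrite /kapp /= mderivX mnm1E eq_sym; have [->|_] := eqVneq; last by rewrite scale0r.
rewrite scale1r [(_ - _)%MM](_ : _ = 0%MM) ?mpolyX0 //.
by apply/mnmP => j; rewrite mnmBE mnm0E subnn.
Qed.

Lemma var_eq a (p p' : 'I_(d (tgt a))) (q q' : 'I_(d (src a))) :
  (var p q == var p' q') = (p == p') && (q == q').
Proof. by rewrite (inj_eq enum_rank_inj) eq_Tagged. Qed.

(** Canonical commutation relation between two entries in the same row [j] of the
    matrix of coordinates: the origin of the correction term in the trace of the
    moment matrix. *)
Lemma partial_coord a (p q : 'I_(d (src a))) (j : 'I_(d (tgt a))) :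
  partialop K j q * coordop K j p
  = coordop K j p * partialop K j q + (p == q)%:R * hbar :> Dh.
Proof.
rewrite -[LHS](subrK (coordop K j p * partialop K j q)) addrC; congr (_ + _).
apply: val_inj.
rewrite [LHS](_ : _ = val (partialop K j q : Dh) * val (coordop K j p : Dh)
  - val (coordop K j p * partialop K j q : Dh)) // val_coord_partial /= expr0 expr1.
rewrite -!mul_polyC mulr1 -mulrA -commr_polyX mulrA -polyCM -mulrBl -polyCB.
have d_partial : derivation (partial K (var j q)) by move=> x y; apply: mderivM.
rewrite [X in X%:P](derivation_commP _).1 //.
rewrite kapp_partialX var_eq eqxx /= eq_sym.
rewrite [RHS](_ : _ = val ((p == q)%:R : Dh) * val (hbar : Dh)) // val_hbar.
congr (_ * _); case: (p == q) => /=.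
  by rewrite [mulop _](_ : _ = 1) //; apply: kendP => x; apply: mul1r.
by rewrite [mulop _](_ : _ = 0) //; apply: kendP => x; apply: mul0r.
Qed.

Lemma tau_arrowsE v :
  tau v = \sum_a \sum_p \sum_q
            cst (v (src a) p q) * (\sum_j coordop K j p * partialop K j q)
        - \sum_a \sum_p \sum_q
            cst (v (tgt a) p q) * (\sum_j coordop K q j * partialop K p j).
Proof.
pose F i (M : 'M[Dh]_(d i)) := \sum_p \sum_q cst (v i p q) * M p q.
have F_zmod i : zmod_morphism (F i).
  move=> M N; rewrite /F -sumrB; apply: eq_bigr => p _; rewrite -sumrB.
  by apply: eq_bigr => q _; rewrite !mxE mulrBr.
pose HFi i := GRing.isZmodMorphism.Build _ _ (F i) (F_zmod i).
pose Fi i : {additive 'M[Dh]_(d i) -> Dh} := HB.pack (F i) (HFi i).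
rewrite [LHS](_ : _ = \sum_i Fi i (tau_mx K d i)) // sum_arrow_blocks.
by congr (_ - _); apply: eq_bigr => a _; apply: eq_bigr => p _;
   apply: eq_bigr => q _; rewrite mxE.
Qed.

Lemma val_tau v : val (tau v) = gl_field v *: 'X.
Proof.
have vs I (r : seq I) (F : I -> Dh) (G : I -> kend Rep) :
    (forall i, val (F i) = G i *: 'X) ->
    val (\sum_(i <- r) F i) = (\sum_(i <- r) G i) *: 'X.
  move=> FG; rewrite [LHS]raddf_sum scaler_suml.
  by apply: eq_bigr => i _; apply: FG.
rewrite tau_arrowsE [LHS]raddfB /gl_field scalerBl.
have cs (c : K) (x : Dh) (D : kend Rep) : val x = D *: 'X ->
    val (cst c * x) = (c *: D) *: 'X.
  move=> xE; rewrite cst_mul val_scale xE map_polyC /= mul_polyC.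
  by rewrite scalerA -scalerAl mul1r.
congr (_ - _); apply: (vs) => a; apply: (vs) => p; apply: (vs) => q;
  by apply: cs; apply: (vs) => j; apply: val_coord_partial.
Qed.

Lemma derivation_gl_field v : derivation (gl_field v).
Proof.
have ds I (r : seq I) (F : I -> kend Rep) :
    (forall i, derivation (F i)) -> derivation (\sum_(i <- r) F i).
  by move=> dF; apply: big_ind => //; [apply: derivation0 | apply: derivationD].
have dp p i : derivation (mulop (p : Rep) * partial K i).
  by apply: derivation_mulop => x y; apply: mderivM.
rewrite /gl_field -[X in _ + X]scaleN1r; apply: derivationD; last apply: derivationZ.
  by apply: (ds) => a; apply: (ds) => p; apply: (ds) => q; apply/derivationZ/(ds).
by apply: (ds) => a; apply: (ds) => p; apply: (ds) => q; apply/derivationZ/(ds).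
Qed.

Definition generic_mx a : 'M[Rep]_(d (tgt a), d (src a)) := \matrix_(p, q) 'X_(var p q).

Lemma var_neq a b (p : 'I_(d (tgt a))) (p' : 'I_(d (tgt b))) q q' :
  a != b -> (var p q == var p' q') = false.
Proof.
move=> ab; apply: contraNF ab; rewrite (inj_eq enum_rank_inj) => /eqP e.
by apply/eqP; apply: (congr1 tag e).
Qed.

(** The vector field of [v] is the derivative of the conjugation action. Only the
    summand of the arrow [b] acts on the coordinates along [b], and each partial
    derivative selects one entry. *)
Lemma gl_field_generic v b :
  map_mx (kapp (gl_field v)) (generic_mx b)
  = generic_mx b *m map_mx (in_alg Rep) (v (src b))
    - map_mx (in_alg Rep) (v (tgt b)) *m generic_mx b.
Proof.
apply/matrixP => p0 q0; rewrite !mxE.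
have kB (D E : kend Rep) x : kapp (D - E) x = kapp D x - kapp E x by [].
have kM p (D : kend Rep) x : kapp (mulop (p : Rep) * D) x = p * kapp D x by [].
rewrite /gl_field kB !kapp_sum; congr (_ - _).
  rewrite (big_only1 b) // => [|a ab _]; last first.
    rewrite kapp_sum big1 // => p _; rewrite kapp_sum big1 // => q _.
    rewrite kappZ kapp_sum big1 ?scaler0 // => j _.
    by rewrite kM kapp_partialX var_neq ?mulr0.
  rewrite kapp_sum; apply: eq_bigr => p _; rewrite kapp_sum !mxE.
  rewrite (big_only1 q0) // => [|q qq0 _]; rewrite kappZ kapp_sum.
    rewrite (big_only1 p0) // => [|j jp0 _]; rewrite kM kapp_partialX var_eq.
      by rewrite !eqxx mulr1 /= -scalerAr mulr1.
    by rewrite (negPf jp0) mulr0.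
  rewrite big1 ?scaler0 // => j _.
  by rewrite kM kapp_partialX var_eq (negPf qq0) andbF mulr0.
rewrite (big_only1 b) // => [|a ab _]; last first.
  rewrite kapp_sum big1 // => p _; rewrite kapp_sum big1 // => q _.
  rewrite kappZ kapp_sum big1 ?scaler0 // => j _.
  by rewrite kM kapp_partialX var_neq ?mulr0.
rewrite kapp_sum (big_only1 p0) // => [|p pp0 _]; rewrite kapp_sum.
  apply: eq_bigr => q _; rewrite !mxE kappZ kapp_sum.
  rewrite (big_only1 q0) // => [|j jq0 _]; rewrite kM kapp_partialX var_eq.
    by rewrite !eqxx mulr1 /= -scalerAl mul1r.
  by rewrite (negPf jq0) andbF mulr0.
rewrite big1 // => q _; rewrite kappZ kapp_sum big1 ?scaler0 // => j _.
by rewrite kM kapp_partialX var_eq (negPf pp0) mulr0.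
Qed.

Lemma map_kapp_scalar m n p (D : kend Rep) (M : 'M[Rep]_(m, n)) (c : 'M[K]_(n, p)) :
  map_mx (kapp D) (M *m map_mx (in_alg Rep) c)
  = map_mx (kapp D) M *m map_mx (in_alg Rep) c.
Proof.
apply/matrixP => i k; rewrite !mxE [LHS](raddf_sum (D : {linear Rep -> Rep})).
apply: eq_bigr => j _; rewrite !mxE /= -!scalerAr !mulr1.
exact: (linearZ_LR (D : {linear Rep -> Rep})).
Qed.

Lemma map_scalar_kapp m n p (D : kend Rep) (c : 'M[K]_(m, n)) (M : 'M[Rep]_(n, p)) :
  map_mx (kapp D) (map_mx (in_alg Rep) c *m M)
  = map_mx (in_alg Rep) c *m map_mx (kapp D) M.
Proof.
apply/matrixP => i k; rewrite !mxE [LHS](raddf_sum (D : {linear Rep -> Rep})).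
apply: eq_bigr => j _; rewrite !mxE /= -!scalerAl !mul1r.
exact: (linearZ_LR (D : {linear Rep -> Rep})).
Qed.

Lemma gl_field_bracket v w :
  comm (gl_field v) (gl_field w) = gl_field (lie_bracket v w).
Proof.
apply: derivation_eq.
- by apply: comm_derivation; apply: derivation_gl_field.
- exact: derivation_gl_field.
move=> i; pose c := enum_val i : Defs.coord d.
have -> : i = var (tagged c).1 (tagged c).2.
  by rewrite /var -surjective_pairing taggedK enum_valK.
move: (tag c) (tagged c).1 (tagged c).2 => a p q {c}.
have entry (D : kend Rep) : kapp D 'X_(var p q) = map_mx (kapp D) (generic_mx a) p q.
  by rewrite !mxE.
have kB (D : kend Rep) m n (M N : 'M[Rep]_(m, n)) :
    map_mx (kapp D) (M - N) = map_mx (kapp D) M - map_mx (kapp D) N.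
  by apply/matrixP => k l; rewrite !mxE; apply: linearB.
(* The matrices [v i] have constant entries, so derivations commute with
   multiplication by them. *)
have comp x y : map_mx (kapp (gl_field x)) (map_mx (kapp (gl_field y)) (generic_mx a)) =
    map_mx (kapp (gl_field x)) (generic_mx a) *m map_mx (in_alg Rep) (y (src a))
    - map_mx (in_alg Rep) (y (tgt a)) *m map_mx (kapp (gl_field x)) (generic_mx a).
  by rewrite gl_field_generic kB map_kapp_scalar map_scalar_kapp.
rewrite !entry; congr (fun_of_matrix _ p q).
rewrite [LHS](_ : _ =
    map_mx (kapp (gl_field v)) (map_mx (kapp (gl_field w)) (generic_mx a))
  - map_mx (kapp (gl_field w)) (map_mx (kapp (gl_field v)) (generic_mx a))); last first.
  by apply/matrixP => k l; rewrite !mxE.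
have mapB k : map_mx (in_alg Rep) (lie_bracket v w k) =
    map_mx (in_alg Rep) (v k) *m map_mx (in_alg Rep) (w k)
    - map_mx (in_alg Rep) (w k) *m map_mx (in_alg Rep) (v k).
  by rewrite -!map_mxM -map_mxB.
by rewrite !comp !gl_field_generic !mapB; apply: mulmx_bracket.
Qed.

Lemma tau_linear (c : K) v w : tau (c *: v + w) = c%:P *: tau v + tau w.
Proof.
rewrite /tau scaler_sumr -big_split; apply: eq_bigr => i _.
rewrite scaler_sumr -big_split; apply: eq_bigr => p _.
rewrite scaler_sumr -big_split; apply: eq_bigr => q _ /=.
rewrite [(c *: v + w) i](_ : _ = c *: v i + w i) // !mxE cst_lin mulrDl.
by rewrite -scalerAl.
Qed.

Lemma tau_deg v : rees_deg 1 (tau v).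
Proof. by move=> i i1; rewrite val_tau coefZ coefX (negPf i1) mulr0. Qed.

Lemma tau_coef1 v : (val (tau v))`_1 = gl_field v.
Proof. by rewrite val_tau coefZ coefX mulr1. Qed.

Lemma tau_bracket v w : comm (tau v) (tau w) = hbar * tau (lie_bracket v w).
Proof.
apply: comm_rees_deg1; rewrite ?tau_coef1; try exact: tau_deg.
exact: gl_field_bracket.
Qed.

Lemma Dh_actE v x : hbar * Dh_act v x = comm (tau v) x.
Proof.
apply: comm_hbar_divK; first exact: tau_deg.
by rewrite tau_coef1; apply: derivation_gl_field.
Qed.

(** * The trace of the moment matrix *)

Lemma target_trace a (m : 'M[K]_(d (tgt a))) :
  \tr (arrow_mx K d a *m coarrow_mx K d a *m map_mx cst m)
  = \sum_p \sum_q cst (m p q) * (\sum_j coordop K q j * partialop K p j).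
Proof.
rewrite /mxtrace [RHS]exchange_big; apply: eq_bigr => q _; rewrite mxE.
apply: eq_bigr => p _; rewrite [map_mx _ _ _ _]mxE mul_cst -cst_mul mxE.
by congr (_ * _); apply: eq_bigr => j _; rewrite !mxE.
Qed.

(** Here the derivations are on the left. Moving them to the right gives one
    [hbar] for each of the [d (tgt a)] terms of a diagonal entry. *)
Lemma source_trace a (m : 'M[K]_(d (src a))) :
  \tr (coarrow_mx K d a *m arrow_mx K d a *m map_mx cst m)
  = \sum_p \sum_q cst (m p q) * (\sum_j coordop K j p * partialop K j q)
    + hbar * cst ((d (tgt a))%:R * \tr m).
Proof.
have entry q p : (coarrow_mx K d a *m arrow_mx K d a) q p =
    \sum_j coordop K j p * partialop K j q + ((p == q)%:R * hbar) *+ d (tgt a).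
  rewrite mxE -[X in _ *+ X]card_ord -sumr_const -big_split.
  by apply: eq_bigr => j _; rewrite !mxE partial_coord.
rewrite /mxtrace exchange_big mulr_sumr raddf_sum mulr_sumr -big_split.
apply: eq_bigr => p _; rewrite mxE.
under [LHS]eq_bigr do rewrite [X in _ * X]mxE entry mul_cst -cst_mul mulrDr.
rewrite big_split; congr (_ + _); rewrite (big_only1 p) // => [|q qp _]; last first.
  by rewrite (negPf qp) mul0r mul0rn mulr0.
rewrite /= eqxx mul1r mulr_natl (raddfMn (cst : {additive K -> Dh})).
by rewrite !mulrnAr cst_mul mul_cst.
Qed.

Definition weighted_trace (J : finType) (c : J -> K) (h : J -> vertex Q) v : K :=
  \sum_x c x * \tr (v (h x)).

Lemma weighted_trace_linear (J : finType) (c : J -> K) h (e : K) v w :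
  weighted_trace c h (e *: v + w) = e * weighted_trace c h v + weighted_trace c h w.
Proof.
rewrite /weighted_trace mulr_sumr -big_split; apply: eq_bigr => x _.
rewrite [(e *: v + w) (h x)](_ : _ = e *: v (h x) + w (h x)) //.
by rewrite mxtraceD mxtraceZ mulrDr mulrCA.
Qed.

Lemma weighted_trace_bracket (J : finType) (c : J -> K) h v w :
  weighted_trace c h (lie_bracket v w) = 0.
Proof.
rewrite /weighted_trace big1 // => x _.
rewrite [lie_bracket v w (h x)](_ : _ = v (h x) *m w (h x) - w (h x) *m v (h x)) //.
by rewrite raddfB /= mxtrace_mulC subrr mulr0.
Qed.

(** The total correction, over all arrows, from moving derivations to the right. *)
Definition source_character : gl_lie K d -> K :=
  weighted_trace (fun a => (d (tgt a))%:R) (@src Q).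

Lemma trace_moment v :
  trace_pairing (moment_mx K d) v = hbar * cst (- source_character v) - tau v.
Proof.
pose F i (M : 'M[Dh]_(d i)) := \tr (M *m map_mx cst (v i)).
have F_zmod i : zmod_morphism (F i).
  by move=> M N; rewrite /F mulmxBl raddfB.
pose HFi i := GRing.isZmodMorphism.Build _ _ (F i) (F_zmod i).
pose Fi i : {additive 'M[Dh]_(d i) -> Dh} := HB.pack (F i) (HFi i).
rewrite [LHS](_ : _ = \sum_i Fi i (moment_mx K d i)) // sum_arrow_blocks.
rewrite tau_arrowsE opprB raddfN mulrN addrCA; congr (_ + _).
  by apply: eq_bigr => a _; apply: target_trace.
rewrite /source_character /weighted_trace -opprD addrC.
rewrite (raddf_sum (cst : {additive K -> Dh})) mulr_sumr -big_split; congr (- _).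
by apply: eq_bigr => a _; apply: source_trace.
Qed.

Lemma trace_identity (r : vertex Q -> K) v :
  trace_pairing (fun j => moment_mx K d j
     + hbar *: \sum_i cst (r i) *: idblock K d i j) v
  = trace_pairing (moment_mx K d) v + hbar * cst (weighted_trace r id v).
Proof.
rewrite /trace_pairing /weighted_trace raddf_sum mulr_sumr -big_split.
apply: eq_bigr => j _ /=.
rewrite mulmxDl raddfD /= (big_only1 j) // => [|i ij _]; last first.
  by rewrite /idblock eq_sym (negPf ij) scaler0.
rewrite /idblock eqxx -!scalemxAl mul1mx !mxtraceZ cstM; congr (_ + _ * (_ * _)).
by rewrite raddf_sum; apply: eq_bigr => i _; rewrite mxE.
Qed.

(** * Quantum moment maps for the conjugation action *)

Lemma Dh_quantum_moment_map (l : gl_lie K d -> K) f :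
  (forall (c : K) v w, l (c *: v + w) = c * l v + l w) ->
  (forall v w, l (lie_bracket v w) = 0) ->
  (forall v, f v = hbar * cst (l v) - tau v) ->
  is_quantum_moment_map (@rees_deg K Rep) (@Dh_act K Q d) f.
Proof.
apply: inner_quantum_moment_map.
- exact: rees_grading.
- exact: rees_hbar_inj.
- exact: rees_deg_hbar.
- exact: tau_linear.
- exact: tau_deg.
- exact: tau_bracket.
- exact: Dh_actE.
- exact: rees_flat.
Qed.

End QuiverMomentMap.

Theorem theorem1p3 (K : closedFieldType) (charK : [pchar K] =i pred0)
    (Q : quiver) (d : vertex Q -> nat) :
  is_quantum_moment_map (@rees_deg K (Rep K d)) (@Dh_act K Q d)
    (fun v => trace_pairing (moment_mx K d) v) /\
  forall r : vertex Q -> K,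
    is_quantum_moment_map (@rees_deg K (Rep K d)) (@Dh_act K Q d)
      (fun v => trace_pairing
        (fun j => moment_mx K d j
           + hbar *: \sum_(i : vertex Q) cst (r i) *: idblock K d i j) v).
Proof.
split=> [|r].
  apply: (Dh_quantum_moment_map (l := fun v => - source_character v)).
  - by move=> c v w; rewrite /source_character weighted_trace_linear opprD mulrN.
  - by move=> v w; rewrite /source_character weighted_trace_bracket oppr0.
  - exact: trace_moment.
apply: (Dh_quantum_moment_map
          (l := fun v => weighted_trace r id v - source_character v)).
- by move=> c v w; rewrite /source_character !weighted_trace_linear opprD addrACA mulrBr.
- by move=> v w; rewrite /source_character !weighted_trace_bracket subrr.
- move=> v; rewrite trace_identity trace_moment raddfB raddfN.
  by rewrite mulrBr mulrN addrC addrA.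
Qed.
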